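(* There exist $X_1,X_2\in\mathbb{M}_3$ with $X_1+X_2=I_3$ such that $$\lambda_2\bigl(|X_1|+|X_2|\bigr)<1.$$ In particular (taking $n=2$ and the expansive matrix $X=I_3\in\mathbb{M}_{2n-1}$), the following general assertion is false: for every $n$, every expansive $X$ in $\mathbb{M}_{2n}$ or $\mathbb{M}_{2n-1}$ and every decomposition $X=\sum_{k=1}^m X_k$ into matrices of the same size, one has $\lambda_n\bigl(\sum_{k=1}^m|X_k|\bigr)\ge 1$.
   Context: $\mathbb{M}_n$ is the set of $n\times n$ complex matrices, $I_3$ is the $3\times 3$ identity matrix, and $|Z|:=(Z^*Z)^{1/2}$, where $Z^*$ is the conjugate transpose of $Z$. For a Hermitian matrix $H$, $\lambda_j(H)$ denotes its $j$th largest eigenvalue (counted with multiplicity). A matrix $X$ is expansive if $|X|\ge I$ in the Loewner (positive semidefinite) order. *)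

(* Defs.v *)
From mathcomp Require Import all_boot all_order all_algebra.
From mathcomp Require Import reals.
From mathcomp Require Import complex.

Set Implicit Arguments.
Unset Strict Implicit.
Unset Printing Implicit Defensive.

Import Order.TTheory GRing.Theory Num.Theory.
Local Open Scope ring_scope.
Local Open Scope sesquilinear_scope.

Section MatrixAbsoluteValue.
Variables (C : numClosedFieldType) (n : nat).
Implicit Types A B H X Z : 'M[C]_n.

(* In C, [0 <= z] says that z is real and nonnegative. *)
Definition psdmx A : Prop :=
  A \is hermsymmx /\ forall v : 'cV[C]_n, 0 <= (v ^t* *m A *m v) 0 0.

Definition loewner A B : Prop := psdmx (B - A).

(* Functional calculus: H = U^* diag(d) U with U := spectralmx H unitary, and
   sqrtC d is the nonnegative square root when 0 <= d.  This is meaningful for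
   positive semidefinite H only. *)
Definition sqrtmx H : 'M[C]_n :=
  (spectralmx H) ^t* *m diag_mx (map_mx sqrtC (spectral_diag H))
    *m spectralmx H.

Definition absmx Z : 'M[C]_n := sqrtmx (Z ^t* *m Z).

Definition expansive X : Prop := loewner 1%:M (absmx X).

(* The complex roots of the characteristic polynomial, with multiplicity. *)
Definition eigenvalues A : seq C :=
  sval (closed_field_poly_normal (char_poly A)).

Lemma char_poly_eigenvalues A :
  char_poly A = \prod_(z <- eigenvalues A) ('X - z%:P).
Proof.
rewrite /eigenvalues; case: closed_field_poly_normal => s /= {1}->.
by rewrite (monicP (char_poly_monic A)) scale1r.
Qed.

Lemma psdmx_diag_conj (d : 'rV[C]_n) D : (forall i, 0 <= d 0 i) ->
  psdmx (D ^t* *m diag_mx d *m D).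
Proof.
move=> d0; split.
  apply/is_hermitianmxP; rewrite expr0 scale1r.
  rewrite !trmx_mul !map_mxM /= trmxCK tr_diag_mx mulmxA; congr (_ *m _ *m _).
  apply/matrixP=> i j; rewrite !mxE rmorphMn /= geC0_conj //.
move=> v.
have -> : v ^t* *m (D ^t* *m diag_mx d *m D) *m v =
          (D *m v) ^t* *m diag_mx d *m (D *m v).
  by rewrite trmx_mul map_mxM !mulmxA.
rewrite mxE sumr_ge0 // => i _; rewrite mul_mx_diag !mxE.
by rewrite mulrAC mulr_ge0 // mulrC mul_conjC_ge0.
Qed.

Lemma gram_psd Z : psdmx (Z ^t* *m Z).
Proof.
have := psdmx_diag_conj Z (d := const_mx 1).
by rewrite diag_const_mx mulmx1; apply=> i; rewrite mxE ler01.
Qed.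

Lemma psdmx_spectralE H : psdmx H ->
  H = (spectralmx H) ^t* *m diag_mx (spectral_diag H) *m spectralmx H.
Proof.
move=> [/hermitian_normalmx/orthomx_spectralP HE _].
by rewrite -invmx_unitary ?spectral_unitarymx.
Qed.

Lemma psdmx_spectral_ge0 H i : psdmx H -> 0 <= spectral_diag H 0 i.
Proof.
move=> Hpsd; have HE := psdmx_spectralE Hpsd; have [_ H0] := Hpsd.
have /unitarymxP UU := spectral_unitarymx H.
set U := spectralmx H in HE UU; set d := spectral_diag H in HE *.
have := H0 (U ^t* *m delta_mx i 0); rewrite {1}HE.
rewrite trmx_mul map_mxM trmxCK !mulmxA -[X in X *m delta_mx i 0]mulmxA UU mulmx1.
rewrite -[X in X *m diag_mx d]mulmxA UU mulmx1.
by rewrite trmx_delta map_delta_mx -rowE -colE !mxE eqxx mulr1n.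
Qed.

Lemma absmx_psd Z : psdmx (absmx Z).
Proof.
by apply: psdmx_diag_conj => i; rewrite mxE sqrtC_ge0 psdmx_spectral_ge0 //; apply: gram_psd.
Qed.

Lemma absmx_sq Z : absmx Z *m absmx Z = Z ^t* *m Z.
Proof.
rewrite [RHS](psdmx_spectralE (gram_psd Z)) /absmx /sqrtmx.
have /unitarymxP UU := spectral_unitarymx (Z ^t* *m Z).
rewrite -!mulmxA; congr (_ *m _); rewrite !mulmxA; congr (_ *m _).
rewrite -[X in X *m _ = _]mulmxA UU mulmx1 mulmx_diag; congr diag_mx.
by apply/rowP=> i; rewrite !mxE -expr2 sqrtCK.
Qed.

End MatrixAbsoluteValue.

(* lambda j H is the j-th largest eigenvalue of H, j = 1, 2, ..., n.  The
   eigenvalues of a Hermitian H are real, so that Re is then only a change of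
   type from R[i] to R. *)
Definition lambda (R : realType) (n : nat) (j : nat) (H : 'M[R[i]]_n) : R :=
  nth 0 (sort >=%R [seq complex.Re z | z <- eigenvalues H]) j.-1.

(* Main.v *)
Require Import Defs.
From mathcomp Require Import all_boot all_order all_algebra.
From mathcomp Require Import reals.
From mathcomp Require Import complex.
Import Order.TTheory GRing.Theory Num.Theory.
Local Open Scope ring_scope.

(** A pair X1, X2 with rational entries is exhibited for which |X1| and |X2|
    are rational too, so that everything reduces to integer arithmetic.

    To find it, write the polar decompositions X1 = U A and X2 = V B.  For fixed
    orthogonal U and V, put W = U^T V; then X1 + X2 = I says A = U^T - W B, and
    the symmetry of A is the linear system W B - B W^T = U^T - U of three
    equations in the six entries of B.  A rational choice of U and V therefore
    leaves a rational three-parameter family of symmetric pairs (A, B), in which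
    positive semidefinite pairs with lambda_2 (A + B) < 1 can be searched for.
    With
<<
          1 [ 2  1  2 ]            1 [ 4 -1 -8 ]
      U = - [ 1  2 -2 ]   and  V = - [-7  4 -4 ]
          3 [-2  2  1 ]            9 [-4 -8 -1 ]
>>
    one such pair is A = P1 / 9, B = P2 / 9 for the integer matrices P1 and P2
    below, with X1 = Z1 / 9 and X2 = Z2 / 9.  The eigenvalues of A + B are
    approximately 5.08, 0.86 and 0.61.

    Two facts turn this into a proof.  First, |X| is the only positive
    semidefinite square root of X^* X ([absmx_unique]); hence |X1| = A follows
    from A^2 = X1^* X1 and a factorisation of A as L^T D L with D diagonal and
    nonnegative, which are identities between integer matrices ([absmx_int]).
    Secondly, lambda_2 can be bounded without computing eigenvalues: the
    characteristic polynomial p of a positive semidefinite 3 x 3 matrix has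
    three real roots, and if p(x) > 0 > p(y) with x <= y, then exactly one of
    them exceeds y ([lambda2_lt]).  Here p(7/9) > 0 > p(1).

    The general assertion fails at n = 2 for X = I_3 = X1 + X2. *)

(** * Positive semidefinite square roots *)

Section SquareRoot.
Local Open Scope sesquilinear_scope.
Variables (C : numClosedFieldType) (n : nat).
Implicit Types A B Z : 'M[C]_n.

Lemma psdmxD A B : psdmx A -> psdmx B -> psdmx (A + B).
Proof.
move=> [/is_hermitianmxP hA pA] [/is_hermitianmxP hB pB]; split.
  apply/is_hermitianmxP; move: hA hB; rewrite !expr0 !scale1r => hA hB.
  by rewrite linearD /= map_mxD -hA -hB.
by move=> v; rewrite mulmxDr mulmxDl mxE addr_ge0.
Qed.

Lemma psdmx_scale (c : C) A : 0 <= c -> psdmx A -> psdmx (c *: A).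
Proof.
move=> c0 [/is_hermitianmxP hA pA]; split.
  apply/is_hermitianmxP; move: hA; rewrite !expr0 !scale1r => hA.
  by rewrite linearZ /= map_mxZ -hA /= geC0_conj.
by move=> v; rewrite -scalemxAr -scalemxAl mxE mulr_ge0.
Qed.

Lemma psdmx_eigenvalue_ge0 A z : psdmx A -> z \in eigenvalues A -> 0 <= z.
Proof.
move=> [_ pA] zA.
have : eigenvalue A z.
  by rewrite eigenvalue_root_char char_poly_eigenvalues root_prod_XsubC.
case/eigenvalueP=> v vA v0.
have := pA (v ^t*); rewrite trmxCK vA -scalemxAl mxE pmulr_lge0 //.
by rewrite -dotmxE dnorm_gt0.
Qed.

(** With D = A - B, the hypothesis A^2 = B^2 reads D A + B D = 0.  On a unit
    eigenvector u of D with eigenvalue d, this gives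
    d (u^* A u + u^* B u) = 0; if d is nonzero, both nonnegative terms vanish,
    and so does d = u^* A u - u^* B u.  Hence all eigenvalues of D are 0. *)
Lemma psdmx_sqrt_inj A B : psdmx A -> psdmx B -> A *m A = B *m B -> A = B.
Proof.
move=> [hA pA] [hB pB] AB.
have hD : A - B \is hermsymmx.
  move: hA hB => /is_hermitianmxP; rewrite expr0 scale1r => hA.
  move=> /is_hermitianmxP; rewrite expr0 scale1r => hB.
  apply/is_hermitianmxP; rewrite expr0 scale1r.
  by rewrite linearB /= map_mxB -hA -hB.
have /unitarymxP UU := spectral_unitarymx (A - B).
have DE : A - B = (spectralmx (A - B)) ^t* *m diag_mx (spectral_diag (A - B))
                    *m spectralmx (A - B).
  rewrite -invmx_unitary ?spectral_unitarymx //.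
  exact/orthomx_spectralP/hermitian_normalmx.
move: UU DE; set U := spectralmx _; set d := spectral_diag _ => UU DE.
suff d0 : d = 0.
  apply/eqP; rewrite -subr_eq0 DE d0; apply/eqP.
  by rewrite [diag_mx 0]linear0 mulmx0 mul0mx.
apply/rowP=> i; rewrite mxE.
(* q M is u^* M u, for the i-th eigenvector u of A - B. *)
pose q M := (U *m M *m U ^t*) i i.
pose u : 'cV[C]_n := U ^t* *m @delta_mx C n 1 i 0.
have qE M : q M = (u ^t* *m M *m u) 0 0.
  rewrite /u trmx_mul map_mxM trmxCK trmx_delta map_delta_mx !mulmxA -colE mxE.
  by rewrite -!mulmxA -rowE mxE /q mulmxA.
have qA : 0 <= q A by rewrite qE.
have qB : 0 <= q B by rewrite qE.
have UD : U *m (A - B) = diag_mx d *m U by rewrite DE !mulmxA UU mul1mx.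
have DU : (A - B) *m U ^t* = U ^t* *m diag_mx d by rewrite DE -!mulmxA UU mulmx1.
have qBr (M M' : 'M_n) : q (M - M') = q M - q M'.
  by rewrite /q mulmxBr mulmxBl !mxE.
have qD : q A - q B = d 0 i.
  by rewrite -qBr /q UD -mulmxA UU mulmx1 mxE eqxx mulr1n.
have qDl M : q ((A - B) *m M) = d 0 i * q M.
  by rewrite /q mulmxA UD -!mulmxA mul_diag_mx mxE.
have qDr M : q (M *m (A - B)) = d 0 i * q M.
  by rewrite /q -!mulmxA DU !mulmxA mul_mx_diag mxE mulrC.
have : d 0 i * (q A + q B) = 0.
  rewrite mulrDr -qDl -qDr.
  have -> : B *m (A - B) = 0 - (A - B) *m A.
    by rewrite mulmxBl mulmxBr AB sub0r opprB.
  rewrite qBr [q 0](_ : _ = 0) ?sub0r ?subrr //.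
  by rewrite /q mulmx0 mul0mx mxE.
move/eqP; rewrite mulf_eq0 => /orP[/eqP//|].
rewrite paddr_eq0 // => /andP[/eqP qA0 /eqP qB0].
by rewrite -qD qA0 qB0 subrr.
Qed.

Lemma absmx_unique Z A :
  psdmx A -> A *m A = Z ^t* *m Z -> absmx Z = A.
Proof.
by move=> pA AZ; apply: psdmx_sqrt_inj (absmx_psd Z) pA _; rewrite absmx_sq AZ.
Qed.

End SquareRoot.

(** * Absolute values and characteristic polynomials of rational matrices *)

Section IntegerMatrices.
Local Open Scope sesquilinear_scope.
Variable C : numClosedFieldType.

Definition intmx {n} (M : 'M[int]_n) : 'M[C]_n := map_mx intr M.

(** The integer k clears the denominators of the factorisation L^T D L that
    certifies the positivity of P. *)
Lemma absmx_int n (N k : nat) (Z P L : 'M[int]_n) (d : 'rV[int]_n) :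
    (0 < k)%N -> (forall i, 0 <= d 0 i) ->
    P *+ k = L^T *m diag_mx d *m L -> P *m P = Z^T *m Z ->
  absmx (N%:R^-1 *: intmx Z) = N%:R^-1 *: intmx P.
Proof.
move=> k0 d0 kP PZ.
have conj_int (M : 'M[int]_n) : (intmx M) ^t* = intmx M^T.
  by apply/matrixP=> i j; rewrite !mxE rmorph_int.
have intmxM (M M' : 'M[int]_n) : intmx (M *m M') = intmx M *m intmx M'.
  exact: map_mxM.
apply: absmx_unique.
  apply: psdmx_scale; first by rewrite invr_ge0 ler0n.
  have -> : intmx P = k%:R^-1 *: intmx (P *+ k).
    rewrite /intmx raddfMn /= -scaler_nat scalerA mulVf ?scale1r //.
    by rewrite pnatr_eq0 -lt0n.
  apply: psdmx_scale; first by rewrite invr_ge0 ler0n.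
  rewrite kP !intmxM -conj_int.
  rewrite [intmx (diag_mx d)](_ : _ = diag_mx (map_mx intr d)).
    by apply: psdmx_diag_conj => i; rewrite mxE ler0z.
  by rewrite /intmx map_diag_mx.
rewrite [_^T]linearZ map_mxZ /= geC0_conj ?invr_ge0 ?ler0n //.
by rewrite conj_int -!scalemxAl -!scalemxAr -!intmxM PZ.
Qed.

Lemma char_poly_int_horner n (N : nat) (M : 'M[int]_n) (k : int) :
  (char_poly (N%:R^-1 *: intmx M)).[k%:~R / N%:R] =
  N%:R^-1 ^+ n * (\det (k%:M - M))%:~R.
Proof.
rewrite -det_map_mx -detZ.
rewrite /char_poly -horner_evalE -det_map_mx; congr (\det _).
apply/matrixP=> i j.
rewrite !mxE /= horner_evalE hornerD hornerN hornerMn hornerX hornerC.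
by rewrite rmorphB rmorphMn /= mulrBr mulrnAr [_ / _]mulrC.
Qed.

End IntegerMatrices.

(** * The second eigenvalue *)

(** Let a >= b >= c be the roots of p.  If b >= y, then (t - a) (t - b) >= 0 for
    t = x and t = y, so p(y) < 0 forces y < c; then x < c too, and
    p(x) <= 0.  The value p(y) < 0 alone would not do: it leaves open that all
    three roots exceed y. *)
Lemma lambda2_lt (R : realType) (S : 'M[R[i]]_3) (x y : R) :
    psdmx S -> x <= y -> 0 < (char_poly S).[x%:C%C] ->
    (char_poly S).[y%:C%C] < 0 ->
  lambda 2 S < y.
Proof.
move=> pS xy; rewrite char_poly_eigenvalues.
rewrite /lambda; set s := sort _ _.
have pE (t : R) : (\prod_(z <- eigenvalues S) ('X - z%:P)).[t%:C%C] =
                  (\prod_(a <- s) (t - a))%:C%C.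
  rewrite horner_prod rmorph_prod (perm_big _ (permEl (perm_sort _ _))) big_map /=.
  apply: eq_big_seq => z /(psdmx_eigenvalue_ge0 _ _ _ _ pS) z0.
  by rewrite hornerXsubC rmorphB /= RRe_real // ger0_real.
rewrite !pE !ltcR.
have : size s = 3.
  rewrite size_sort size_map; apply: succn_inj.
  by rewrite -(size_prod_XsubC _ id) -char_poly_eigenvalues size_char_poly.
have : sorted >=%R s by apply: sort_sorted => a b; exact: le_total.
case: s {pE} => [|a [|b [|c []]]] //= /and3P[ba cb _] _.
rewrite !big_cons !big_nil !mulr1 => px py; rewrite ltNge; apply/negP=> yb.
have ab_ge0 (t : R) : t <= b -> 0 <= (t - a) * (t - b).
  by move=> tb; rewrite mulr_le0 // subr_le0 // (le_trans tb).
have yc : y < c.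
  rewrite ltNge; apply: contraTN py => cy.
  by rewrite -leNgt mulrA mulr_ge0 ?ab_ge0 ?subr_ge0.
move: px; rewrite mulrA; apply/negP; rewrite -leNgt.
rewrite mulr_ge0_le0 ?ab_ge0 ?(le_trans xy yb) // subr_le0.
exact: le_trans xy (ltW yc).
Qed.

(** * The matrices of the counterexample *)

Definition mx3 (s : seq (seq int)) : 'M[int]_3 := \matrix_(i, j) (nth [::] s i)`_j.

(* Big operators and determinants are opaque to computation, hence the expansion
   to closed integer expressions first. *)
Ltac mx3_eval :=
  let i := fresh in let j := fresh in apply/matrixP => i j;
  case: i => [[|[|[|//]]] ?]; case: j => [[|[|[|//]]] ?];
  repeat progress rewrite ?mxE ?big_ord_recl ?big_ord0; by vm_compute.

Ltac det3_eval :=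
  rewrite (expand_det_row _ 0) !big_ord_recl big_ord0 /cofactor
    !(expand_det_row _ 0) !big_ord_recl !big_ord0 /cofactor !det_mx11 !mxE;
  by vm_compute.

Definition Z1 := mx3 [:: [:: 2; 11; 11]; [:: 4; 0; -3]; [:: -5; 11; 14]].
Definition Z2 := mx3 [:: [:: 7; -11; -11]; [:: -4; 9; 3]; [:: 5; -11; -5]].
Definition P1 := mx3 [:: [:: 6; 0; -3]; [:: 0; 11; 11]; [:: -3; 11; 14]].
Definition P2 := mx3 [:: [:: 4; -7; -5]; [:: -7; 15; 7]; [:: -5; 7; 9]].

(** Completing squares, the quadratic form of 2 P1 is
    3 (2x - z)^2 + 22 (y + z)^2 + 3 z^2. *)
Lemma absmx_Z1 (C : numClosedFieldType) :
  absmx (9%:R^-1 *: intmx C Z1) = 9%:R^-1 *: intmx C P1.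
Proof.
pose L := mx3 [:: [:: 2; 0; -1]; [:: 0; 1; 1]; [:: 0; 0; 1]].
apply: (@absmx_int _ _ _ 2 _ _ L (\row_j [:: 3; 22; 3]`_j)) => //.
- by move=> [[|[|[|//]]] ?]; rewrite mxE.
- mx3_eval.
- mx3_eval.
Qed.

(** Completing squares, the quadratic form of 4 P2 is
    (4x - 7y - 5z)^2 + 2 (y + z)^2 + 9 (y - z)^2. *)
Lemma absmx_Z2 (C : numClosedFieldType) :
  absmx (9%:R^-1 *: intmx C Z2) = 9%:R^-1 *: intmx C P2.
Proof.
pose L := mx3 [:: [:: 4; -7; -5]; [:: 0; 1; 1]; [:: 0; 1; -1]].
apply: (@absmx_int _ _ _ 4 _ _ L (\row_j [:: 1; 2; 9]`_j)) => //.
- by move=> [[|[|[|//]]] ?]; rewrite mxE.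
- mx3_eval.
- mx3_eval.
Qed.

Lemma det_9_sub : \det (9%:M - (P1 + P2)) = - 156%:Z.
Proof. det3_eval. Qed.

Lemma det_7_sub : \det (7%:M - (P1 + P2)) = 44%:Z.
Proof. det3_eval. Qed.

Lemma exists_lambda2_lt1 (R : realType) :
  exists X1 X2 : 'M[R[i]]_3,
    X1 + X2 = 1%:M /\ lambda 2 (absmx X1 + absmx X2) < 1.
Proof.
have n9 : (9%:R : R[i]) != 0 by rewrite pnatr_eq0.
exists (9%:R^-1 *: intmx _ Z1), (9%:R^-1 *: intmx _ Z2); split.
  rewrite -scalerDr /intmx -map_mxD (_ : Z1 + Z2 = 9%:M); last by mx3_eval.
  by rewrite map_scalar_mx scale_scalar_mx mulVf.
have pS := psdmxD _ _ _ _ (absmx_psd (9%:R^-1 *: intmx R[i] Z1))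
                         (absmx_psd (9%:R^-1 *: intmx R[i] Z2)).
move: pS; rewrite absmx_Z1 absmx_Z2 -scalerDr /intmx -map_mxD => pS.
have c9 : 0 < (9%:R^-1 ^+ 3 : R[i]) by rewrite exprn_gt0 // invr_gt0 ltr0n.
apply: (@lambda2_lt _ _ (7%:R / 9%:R)) => //.
- by rewrite ler_pdivrMr ?ltr0n // mul1r ler_nat.
- have -> : (7%:R / 9%:R : R)%:C%C = 7%:~R / 9%:R.
    by rewrite rmorphM fmorphV !rmorph_nat.
  by rewrite char_poly_int_horner det_7_sub pmulr_rgt0 // ltr0z.
- have -> : (1 : R)%:C%C = 9%:~R / 9%:R by rewrite divff.
  by rewrite char_poly_int_horner det_9_sub pmulr_rlt0 // ltrz0.
Qed.

Lemma expansive1 (C : numClosedFieldType) n : expansive (1%:M : 'M[C]_n).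
Proof.
have adj1 : map_mx Num.conj (1%:M^T : 'M[C]_n) = 1%:M.
  by rewrite trmx1 map_mx1.
have p1 : psdmx (1%:M : 'M[C]_n).
  by have := gram_psd (1%:M : 'M[C]_n); rewrite mulmx1 adj1.
have abs1 : absmx (1%:M : 'M[C]_n) = 1%:M.
  by apply: absmx_unique => //; rewrite adj1.
by rewrite /expansive /loewner abs1 subrr -(scale0r 1%:M); apply: psdmx_scale.
Qed.

Theorem proposition2p7 (R : realType) :
  (exists X1 X2 : 'M[R[i]]_3,
      X1 + X2 = 1%:M /\ lambda 2 (absmx X1 + absmx X2) < 1) /\
  expansive (1%:M : 'M[R[i]]_3) /\
  ~ (forall n : nat, (0 < n)%N ->
     forall N : nat, N = (2 * n)%N \/ N = (2 * n - 1)%N ->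
     forall X : 'M[R[i]]_N, expansive X ->
     forall (m : nat) (Xs : 'I_m -> 'M[R[i]]_N), X = \sum_(k < m) Xs k ->
     1 <= lambda n (\sum_(k < m) absmx (Xs k))).
Proof.
split; first exact: exists_lambda2_lt1.
split; first exact: expansive1.
move=> H; have [X1 [X2 [X12 lt1]]] := exists_lambda2_lt1 R.
have := H 2%N isT 3%N (or_intror erefl) 1%:M (expansive1 _ _) 2%N
  (fun k => if k == 0 then X1 else X2).
rewrite !big_ord_recl !big_ord0 /= !addr0 => /(_ (esym X12)).
by rewrite leNgt lt1.
Qed.
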